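(* The spanning variant of subgraph reconfiguration under the TJ rule can be solved in linear time for the property ''a graph is a tree.''
   Context: Graphs are finite, simple and undirected. In the spanning variant for property $\Pi$ on a graph $G$, a feasible solution is a vertex subset $V'\subseteq V(G)$ such that $G[V']$ contains a spanning subgraph satisfying $\Pi$ (for $\Pi$ = ''is a tree'', this means $G[V']$ is connected). Under the token jumping (TJ) rule, two feasible solutions $X,Y$ are adjacent if $|X\setminus Y|=|Y\setminus X|=1$. A reconfiguration sequence is a sequence of feasible solutions in which consecutive ones are adjacent. The problem: given $G$ and feasible source and target solutions $V_s,V_t$, decide whether a reconfiguration sequence from $V_s$ to $V_t$ exists. *)

(* Defs.v *)
From HB Require Import structures.
From mathcomp Require Import all_boot.

Set Implicit Arguments.
Unset Strict Implicit.
Unset Printing Implicit Defensive.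

Record sgraph := SGraph {
  vertex :> finType;
  edge : rel vertex;
  edge_sym : symmetric edge;
  edge_irr : irreflexive edge
}.

Definition edge_set (G : sgraph) : {set {set G}} :=
  [set [set p.1; p.2] | p : G * G & edge p.1 p.2].

Section Induced.
Variables (G : sgraph) (S : {set G}).

Definition induced_edge : rel {x : G | x \in S} :=
  fun x y => edge (val x) (val y).

Lemma induced_edge_sym : symmetric induced_edge.
Proof. by move=> x y; apply: edge_sym. Qed.

Lemma induced_edge_irr : irreflexive induced_edge.
Proof. by move=> x; apply: edge_irr. Qed.

Definition induced : sgraph := SGraph induced_edge_sym induced_edge_irr.
End Induced.

Definition connected (G : sgraph) : Prop :=
  0 < #|G| /\ forall x y : G, connect (@edge G) x y.

(* [ucycle] also accepts the empty cycle and the sequence [:: x; y] for an edge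
   xy; a genuine cycle of a simple graph has at least three vertices. *)
Definition acyclic (G : sgraph) : Prop :=
  forall c : seq G, ucycle (@edge G) c -> size c < 3.

Definition is_tree (G : sgraph) : Prop := connected G /\ acyclic G.

Definition has_spanning_subgraph (Pi : sgraph -> Prop) (G : sgraph) : Prop :=
  exists (h : rel G) (h_sym : symmetric h) (h_irr : irreflexive h),
    subrel h (@edge G) /\ Pi (SGraph h_sym h_irr).

Definition feasible (Pi : sgraph -> Prop) (G : sgraph) (S : {set G}) : Prop :=
  has_spanning_subgraph Pi (induced S).

Definition token_jump (G : sgraph) : rel {set G} :=
  fun X Y => (#|X :\: Y| == 1) && (#|Y :\: X| == 1).

Definition reconfigurable (Pi : sgraph -> Prop) (G : sgraph)
    (Vs Vt : {set G}) : Prop :=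
  exists p : seq {set G},
    [/\ forall X, X \in Vs :: p -> feasible Pi X,
        path (@token_jump G) Vs p
      & last Vs p = Vt].

(* Registers and memory cells hold natural numbers, and each instruction costs
   one step. [Ld d a] and [St a b] address the memory indirectly, through the
   contents of register [a]; [Sub] is truncated subtraction; [Jz a l] jumps to
   instruction [l] when register [a] is zero. The machine halts when the program
   counter leaves the program. *)
Inductive instr :=
  | Cst (d k : nat)
  | Add (d a b : nat)
  | Sub (d a b : nat)
  | Ld (d a : nat)
  | St (a b : nat)
  | Jz (a l : nat).

Definition program := seq instr.

Record state := State { pc : nat; reg : nat -> nat; ram : nat -> nat }.

Definition upd (f : nat -> nat) (i v : nat) : nat -> nat :=
  fun j => if j == i then v else f j.

Definition exec (i : instr) (s : state) : state :=
  let: State q r m := s in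
  match i with
  | Cst d k => State q.+1 (upd r d k) m
  | Add d a b => State q.+1 (upd r d (r a + r b)) m
  | Sub d a b => State q.+1 (upd r d (r a - r b)) m
  | Ld d a => State q.+1 (upd r d (m (r a))) m
  | St a b => State q.+1 r (upd m (r a) (r b))
  | Jz a l => State (if r a == 0 then l else q.+1) r m
  end.

Definition halted (P : program) (s : state) : bool := size P <= pc s.

Definition step (P : program) (s : state) : state :=
  if onth P (pc s) is Some i then exec i s else s.

Definition run (P : program) (t : nat) (s : state) : state :=
  iter t (step P) s.

Definition init (w : seq nat) : state := State 0 (fun _ => 0) (nth 0 w).

Definition fits (B : nat) (s : state) : Prop :=
  forall k, reg s k <= B /\ ram s k <= B.

Definition computes (P : program) (w : seq nat) (T B : nat) (b : bool) : Prop :=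
  exists t, [/\ t <= T,
                halted P (run P t (init w)),
                reg (run P t (init w)) 0 = b
              & forall i, i <= t -> fits B (run P i (init w))].

(* [encodes x w] is a relation because one instance may have several
   encodings; an algorithm has to be correct on all of them. *)
Record problem := Problem {
  instance : Type;
  promise : instance -> Prop;
  answer : instance -> Prop;
  isize : instance -> nat;
  encodes : instance -> seq nat -> Prop
}.

(* The bound [(N + 2) ^ c] on the numbers in use says that words have
   O(log N) bits, so that charging one step per instruction is legitimate. *)
Definition linear_time (Q : problem) : Prop :=
  exists (P : program) (c : nat),
    forall (x : instance Q) (w : seq nat),
      promise x -> encodes x w ->
      exists b : bool,
        (b <-> answer x) /\
        computes P w (c * (isize x).+1) ((isize x).+2 ^ c) b.

Record reconf_instance := ReconfInstance {
  graph : sgraph;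
  source : {set graph};
  target : {set graph}
}.

Definition block (G : sgraph) (vs s : seq G) : seq nat :=
  size s :: [seq index v vs | v <- s].

(* The vertices are numbered 0, ..., n - 1 according to an arbitrary
   enumeration [vs]. The input consists of n, the adjacency list of each vertex
   in turn, the list of source vertices and the list of target vertices, each
   list in arbitrary order and preceded by its length. *)
Definition reconf_encodes (x : reconf_instance) (w : seq nat) : Prop :=
  exists (vs : seq (graph x)) (adj : graph x -> seq (graph x))
         (ss ts : seq (graph x)),
    [/\ uniq vs /\ (forall v, v \in vs),
        forall v, uniq (adj v) /\ (forall u, (u \in adj v) = edge v u),
        uniq ss /\ ss =i source x,
        uniq ts /\ ts =i target x
      & w = #|graph x| :: flatten [seq block vs (adj v) | v <- vs]
              ++ block vs ss ++ block vs ts].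

Definition spanning_tj_reconf (Pi : sgraph -> Prop) : problem := {|
  instance := reconf_instance;
  promise x := feasible Pi (source x) /\ feasible Pi (target x);
  answer x := reconfigurable Pi (source x) (target x);
  isize x := #|graph x| + #|edge_set (graph x)|;
  encodes := reconf_encodes
|}.

(* Main.v *)
Require Import Defs.
From mathcomp Require Import all_boot.
From mathcomp Require Import zify.

(* Feasibility for trees means that the chosen vertices induce a nonempty
   connected subgraph. A jump preserves the number of tokens and, when there are
   at least two, the connected component. Conversely, let X and Y be connected
   sets of the same size, with at least two vertices, in one component. Moving
   tokens along a path makes X meet Y; then, as long as a connected set I common
   to X and Y is not all of Y, some neighbour v of I lies in Y, and a token of X
   on a non-cut vertex outside I can jump to v if v is not yet occupied. Hence
   the answer is yes iff |X| = |Y| and either |X| = 1 or X and Y lie in the same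
   component, which a breadth-first search decides in linear time. *)

Set Implicit Arguments.
Unset Strict Implicit.
Unset Printing Implicit Defensive.

(** * Connected vertex sets and token jumping *)

Lemma connect_exit (T : finType) (e : rel T) (A : pred T) x y :
  connect e x y -> A x -> ~~ A y -> exists u v, [/\ A u, ~~ A v & e u v].
Proof.
move/connectP => [p]; elim: p x => [|z p IHp] x /=; first by move=> _ -> ->.
case/andP=> exz pz yE Ax Ay.
by have [Az|Az] := boolP (A z); [apply: IHp pz yE Az Ay | exists x, z].
Qed.

(** * Trees given by a parent function and a depth *)

Section Tree.
Variables (T : sgraph) (r : T) (p : T -> T) (d : T -> nat).
Hypothesis pE : forall x y, edge x y = (x != r) && (p x == y) || (y != r) && (p y == x).
Hypothesis dp : forall x, x != r -> d (p x) < d x.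

Lemma parent_connected : connected T.
Proof.
split; first by apply/card_gt0P; exists r.
have cr x : connect (@edge T) x r.
  move: {2}(d x).+1 (ltnSn (d x)) => k; elim: k x => // k IHk x dk.
  have [->|xr] := eqVneq x r; first exact: connect0.
  apply: connect_trans (IHk (p x) _); last by have := dp xr; lia.
  by apply: connect1; rewrite pE xr eqxx.
move=> x y; apply: connect_trans (cr x) _.
by rewrite sym_connect_sym //; apply: edge_sym.
Qed.

(* Both neighbours on a cycle of a vertex of maximal depth would be its parent. *)
Lemma parent_acyclic : acyclic T.
Proof.
move=> c /andP[cc uc]; case: ltnP => // sc.
have [x0 x0c] : exists x0, x0 \in c.
  by case: c sc {cc uc} => // a l _; exists a; rewrite inE eqxx.
have [x xc xmax] := arg_maxnP d x0c.
have dmax y : y \in c -> edge x y -> y = p x.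
  move=> yc; rewrite pE => /orP[/andP[_ /eqP<-//]|/andP[yr /eqP px]].
  have := xmax y yc; have := dp yr; rewrite px; lia.
have nx : next c x = p x by apply: dmax; [rewrite mem_next | apply: next_cycle].
have px : prev c x = p x.
  by apply: dmax; [rewrite mem_prev | rewrite edge_sym; apply: prev_cycle].
have xi : index x c < size c by rewrite index_mem.
move: nx px {dmax xmax cc}.
(* Rotated so that [x] comes first, the cycle has its second entry as [next] and its last as [prev].
   Among three or more distinct vertices these differ. *)
have := rot_to xc => -[i c' E].
have uE : uniq (x :: c') by rewrite -E rot_uniq.
have sE : size c = (size c').+1 by rewrite -(size_rot i) E.
rewrite -(next_rot i) // -(prev_rot i) // E.
case: c' uE sE {E} => [|a [|b l]] uE sE; rewrite ?sE // in sc *.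
have [xl al] : x \notin a :: b :: l /\ a \notin b :: l by case/and3P: uE.
rewrite prev_nth inE eqxx (memNindex xl) -[size _]/(size [:: x, a, b & l]).-1.
rewrite nth_last /next /= eqxx => <- ab.
by rewrite -ab mem_last in al.
Qed.
End Tree.

(** * Connectivity expressed by cuts *)

Section Linked.
Variable G : sgraph.
Implicit Types (S A I J X Y : {set G}) (u v x y : G).

(** Connectivity of the induced subgraph in cut form, so that subsets of [S] can be grown vertex by
    vertex without paths inside [S]. *)
Definition linked S : Prop :=
  S != set0 /\
  forall A, A != set0 -> A \proper S ->
    exists u v, [/\ u \in A, v \in S, v \notin A & edge u v].

Lemma linked1 x : linked [set x].
Proof.
split; first by apply/set0Pn; exists x; rewrite inE.
by move=> A /set0Pn[y yA]; rewrite properE subset1 => /andP[/orP[]/eqP eA];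
  rewrite eA ?subxx // inE in yA *.
Qed.

(** A cut [A] that misses [S] is [{v}], and one that contains [S] misses [v]: the edge [uv] crosses
    both. Any other [A] cuts [S] itself. *)
Lemma linkedU1 S u v : linked S -> u \in S -> edge u v -> linked (v |: S).
Proof.
move=> [S0 Scut] uS uv; split; first by apply/set0Pn; exists v; rewrite !inE eqxx.
move=> A A0 /properP[AvS [w wvS wA]].
have [SA0|SA0] := eqVneq (S :&: A) set0.
  have SA z : z \in S -> z \notin A.
    by move=> zS; apply/negP => zA; move/setP/(_ z): SA0; rewrite !inE zS zA.
  have /set0Pn[z zA] := A0.
  have zv : z = v.
    move: (subsetP AvS z zA); rewrite !inE => /orP[/eqP//|/SA]; by rewrite zA.
  exists z, u; rewrite zA SA // !inE uS orbT; split=> //.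
  by rewrite zv edge_sym.
have [SSA|SSA] := boolP (S \subset A).
  exists u, v; rewrite (subsetP SSA) // !inE eqxx; split=> //.
  by move: wvS; rewrite !inE => /orP[/eqP<-//|/(subsetP SSA)]; rewrite (negPf wA).
have [|a [b [aSA bS bSA ab]]] := Scut (S :&: A) SA0.
  by rewrite properE subsetIl subsetI subxx.
move: aSA bSA; rewrite !inE bS => /andP[_ aA] /= bA.
by exists a, b; rewrite !inE bS orbT.
Qed.

(** Growth principle: as long as the part built from [I] is not all of [S], some edge leaves it
    inside [S]. Induction on the number of missing vertices. *)
Lemma linked_ind S I (P : {set G} -> Prop) :
    linked S -> I != set0 -> I \subset S -> P I ->
    (forall A u v, I \subset A -> P A -> u \in A -> v \in S -> v \notin A ->
       edge u v -> P (v |: A)) ->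
  P S.
Proof.
move=> [_ Scut] I0 IS PI Pgrow.
suff: forall k A, I \subset A -> A \subset S -> P A -> #|S :\: A| = k -> P S.
  by move=> H; apply: H (subxx I) IS PI erefl.
elim=> [|k IHk] A IA AS PA cSA.
  suff -> : S = A by [].
  by apply/eqP; rewrite eqEsubset AS -setD_eq0 -cards_eq0 cSA.
have [||u [v [uA vS vA uv]]] := Scut A.
- by apply: contraNneq I0 => A0; rewrite -subset0 -A0.
- rewrite properE AS /= -setD_eq0 -cards_eq0; lia.
apply: (IHk (v |: A)); last 1 first.
- have -> : S :\: (v |: A) = (S :\: A) :\ v.
    by apply/setP => z; rewrite !inE negb_or andbA.
  have := cardsD1 v (S :\: A); rewrite inE vA vS cSA /=; lia.
- exact: subset_trans IA (subsetUr _ _).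
- by rewrite subUset sub1set vS.
- exact: Pgrow uv.
Qed.

Lemma linked_connect S x y :
  linked S -> x \in S -> y \in S -> connect (@edge G) x y.
Proof.
move=> lS xS; move: y.
apply: (linked_ind (I := [set x])
  (P := fun A => forall y, y \in A -> connect (@edge G) x y) lS);
  rewrite ?sub1set //.
- by apply/set0Pn; exists x; rewrite inE.
- by move=> z; rewrite inE => /eqP->.
move=> A u v _ IHA uA _ _ uv z; rewrite !inE => /orP[/eqP->|/IHA//].
exact: connect_trans (IHA u uA) (connect1 uv).
Qed.

(* The vertex absorbed last when [I] is grown to [X] is a non-cut vertex of [X]. *)
Lemma linked_split I X :
    linked I -> linked X -> I \proper X ->
  exists J x, [/\ linked J, I \subset J, x \notin J & X = x |: J].
Proof.
move=> lI lX /andP[IX XI].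
have nIX : X != I by apply: contraNneq XI => ->.
suff [_] : linked X /\ (X != I -> exists J x,
    [/\ linked J, I \subset J, x \notin J & X = x |: J]) by apply.
apply: (linked_ind (I := I) (P := fun A => linked A /\ (A != I -> exists J x,
    [/\ linked J, I \subset J, x \notin J & A = x |: J])) lX) => //.
- by case: lI.
- by split; rewrite ?eqxx.
move=> A u v IA [lA _] uA vX vA uv; split; first exact: linkedU1 uv.
by exists A, v.
Qed.

(** A path of the spanning tree from a vertex in a cut to one outside it must cross the cut along an
    edge of [G]. *)
Lemma feasible_linked S : feasible is_tree S -> linked S.
Proof.
case=> h [hs [hi [hsub [[c0 hc] _]]]]; split.
  by have /card_gt0P[x _] := c0; apply/set0Pn; exists (val x); apply: valP.
move=> A /set0Pn[a aA] /properP[AS [b bS bA]].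
have aS := subsetP AS _ aA.
have := connect_exit (A := fun z => val z \in A)
  (hc (exist _ a aS : vertex (SGraph hs hi)) (exist _ b bS)) aA bA.
case=> u [v [uA vA uv]]; exists (val u), (val v); split=> //; first exact: valP.
exact: hsub _ _ uv.
Qed.

(** Parent pointers for a tree on [A] rooted at [r]; the decreasing depth [d] is the certificate of
    acyclicity. *)
Definition tree_on r A (p : G -> G) (d : G -> nat) :=
  forall x, x \in A -> x != r -> [/\ p x \in A, edge x (p x) & d (p x) < d x].

Lemma linked_tree_on S r : linked S -> r \in S -> exists p d, tree_on r S p d.
Proof.
move=> lS rS.
apply: (linked_ind (I := [set r]) (P := fun A => exists p d, tree_on r A p d)
  lS); rewrite ?sub1set //.
- by apply/set0Pn; exists r; rewrite inE.
- by exists id, (fun=> 0) => x; rewrite inE => ->.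
move=> A u v _ [p [d tA]] uA vS vA uv.
(* The new vertex [v] becomes a leaf below [u]. *)
exists (fun x => if x == v then u else p x),
       (fun x => if x == v then (d u).+1 else d x) => x.
rewrite !inE; case: (eqVneq x v) => [->|xv] /=.
  move=> _ _; rewrite uA orbT edge_sym uv; split=> //.
  by case: eqVneq uA => // ->; rewrite (negPf vA).
move=> xA xr; have [pA -> dp] := tA x xA xr; rewrite pA orbT; split=> //.
by case: eqVneq pA => // ->; rewrite (negPf vA).
Qed.


Lemma linked_feasible S : linked S -> feasible is_tree S.
Proof.
move=> lS; have /set0Pn[r rS] := lS.1.
have [p [d tS]] := linked_tree_on lS rS.
pose V := {z : G | z \in S}.
pose h : rel V := fun x y : V =>
  (val x != r) && (p (val x) == val y) || (val y != r) && (p (val y) == val x).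
have hs : symmetric h by move=> x y; rewrite /h orbC.
have dp (x : V) : val x != r -> d (p (val x)) < d (val x).
  by move=> xr; have [] := tS _ (valP x) xr.
have hi : irreflexive h.
  move=> x; rewrite /h orbb; apply/negP => /andP[/dp dpx /eqP px].
  by rewrite px ltnn in dpx.
have he : subrel h (@edge (induced S) : rel V).
  move=> x y /orP[]/andP[nr /eqP pE]; rewrite /edge /= /induced_edge -pE.
    by have [] := tS _ (valP x) nr.
  by rewrite edge_sym; have [] := tS _ (valP y) nr.
pose r' : V := exist _ r rS.
(* Away from the root [p] stays in [S]; the default [r'] can occur only at the root, whose parent
   [h] ignores. *)
pose p' (x : V) : V := insubd r' (p (val x)).
have pE (x y : V) : val x != r -> (p' x == y) = (p (val x) == val y).
  move=> xr; have [pS _ _] := tS _ (valP x) xr.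
  by rewrite -(inj_eq val_inj) insubdK.
have hE (x y : V) : h x y = (x != r') && (p' x == y) || (y != r') && (p' y == x).
  have r'E z : (z != r') = (val z != r) by rewrite -(inj_eq val_inj).
  rewrite /h !r'E.
  by case: (boolP (val x != r)) => [/pE->|_];
    case: (boolP (val y != r)) => [/pE->|_].
have d' (x : V) : x != r' -> d (val (p' x)) < d (val x).
  rewrite -val_eqE /= => xr; have [pS _ _] := tS _ (valP x) xr.
  by rewrite /p' insubdK // dp.
exists h, hs, hi; split=> //; split.
  exact: (@parent_connected (SGraph hs hi) r' p' (d \o val)).
exact: (@parent_acyclic (SGraph hs hi) r' p' (d \o val)).
Qed.

(** * Constructing jumps *)

(** The token to move is on a non-cut vertex of [X] outside [I]. The rest still contains [I], hence
    [u], so adding [v] keeps it connected. *)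
Lemma linked_swap I X u v :
    linked I -> linked X -> I \proper X -> u \in I -> v \notin X -> edge u v ->
  exists X', [/\ linked X', token_jump X X', v |: I \subset X' & #|X'| = #|X|].
Proof.
move=> lI lX IX uI vX uv.
have [J [x [lJ IJ xJ XE]]] := linked_split lI lX IX.
have vJ : v \notin J by apply: contra vX; rewrite XE !inE orbC => ->.
have vx : v != x by apply: contraNneq vX => ->; rewrite XE !inE eqxx.
exists (v |: J); split.
- exact: linkedU1 (subsetP IJ u uI) uv.
- rewrite /token_jump XE; apply/andP; split; apply/cards1P.
    exists x; apply/setP => z; rewrite !inE.
    have [->|/=] := eqVneq z x; first by rewrite eq_sym (negPf vx) xJ.
    by case: (z \in J); rewrite ?orbT ?andbF.
  exists v; apply/setP => z; rewrite !inE.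
  have [->|/=] := eqVneq z v; first by rewrite (negPf vx) vJ.
  by case: (z \in J); rewrite ?orbT ?andbF.
- exact: setUS.
- by rewrite XE !cardsU1 vJ xJ.
Qed.

Lemma reconfigurable_refl X : linked X -> reconfigurable is_tree X X.
Proof.
by move=> lX; exists [::]; split=> // Y; rewrite inE => /eqP->; apply: linked_feasible.
Qed.

Lemma reconfigurable_step X X' Y :
    linked X -> token_jump X X' -> reconfigurable is_tree X' Y ->
  reconfigurable is_tree X Y.
Proof.
move=> lX XX' [p [fp pp lp]]; exists (X' :: p); split; rewrite ?lp //= ?XX' //.
by move=> Z; rewrite inE => /orP[/eqP->|/fp //]; apply: linked_feasible.
Qed.

(** Induction on [#|Y| - #|I|]. The set [I] holds the tokens already in place; jumping tokens are
    always taken from outside it. *)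
Lemma reconfigurable_from_common I X Y :
    linked I -> linked X -> linked Y -> I \subset X -> I \subset Y ->
  #|X| = #|Y| -> reconfigurable is_tree X Y.
Proof.
move=> + + lY; move: {2}(#|Y| - #|I|) (leqnn (#|Y| - #|I|)) => k.
elim: k I X => [|k IHk] I X Ik lI lX IX IY cXY.
  have YI : Y = I by apply/esym/eqP; rewrite eqEcard IY; lia.
  suff -> : X = Y by apply: reconfigurable_refl.
  by apply/esym/eqP; rewrite eqEcard cXY leqnn YI IX.
have [YI|nYI] := eqVneq I Y.
  suff -> : X = Y by apply: reconfigurable_refl.
  by apply/esym/eqP; rewrite eqEcard cXY leqnn -YI IX.
have IpY : I \proper Y by rewrite properEneq nYI.
have [u [v [uI vY vI uv]]] := lY.2 I lI.1 IpY.
have cI := proper_card IpY.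
have lI' := linkedU1 lI uI uv.
have cI' : #|v |: I| = #|I|.+1 by rewrite cardsU1 vI.
have I'k : #|Y| - #|v |: I| <= k.
  by rewrite cI' subnS -subn1 leq_subLR add1n.
have I'Y : v |: I \subset Y by rewrite subUset sub1set vY.
have [vX|vX] := boolP (v \in X).
  by apply: (IHk (v |: I)); rewrite // subUset sub1set vX.
have IpX : I \proper X by rewrite properEcard IX cXY.
have [X' [lX' XX' I'X' cX']] := linked_swap lI lX IpX uI vX uv.
apply: (reconfigurable_step lX XX').
by apply: (IHk (v |: I)); rewrite // cX'.
Qed.

(** Induction along the path: if its next vertex is unoccupied, a token other than the one on [x]
    jumps there, which is where two tokens are required. *)
Lemma reconfigurable_connect X Y x y :
    linked X -> linked Y -> x \in X -> y \in Y -> connect (@edge G) x y ->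
  1 < #|X| -> #|X| = #|Y| -> reconfigurable is_tree X Y.
Proof.
move=> lX lY xX yY /connectP[p]; elim: p x X lX xX => [|v p IHp] x X lX xX /=.
  move=> _ yx _ cXY; rewrite yx in yY.
  by apply: (reconfigurable_from_common (linked1 x)) => //; rewrite sub1set.
case/andP=> xv vp yl X1 cXY.
have [vX|vX] := boolP (v \in X); first exact: IHp vX vp yl X1 cXY.
have xpX : [set x] \proper X by rewrite properEcard sub1set xX cards1.
have [X' [lX' XX' vX' cX']] := linked_swap (linked1 x) lX xpX (set11 x) vX xv.
apply: (reconfigurable_step lX XX').
apply: (IHp v) => //; rewrite ?cX' //.
by apply: (subsetP vX'); rewrite !inE eqxx.
Qed.

(** * Invariants of token jumping and the resulting criterion *)

Lemma token_jump_card X Y : token_jump X Y -> #|X| = #|Y|.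
Proof.
move=> /andP[/eqP XY /eqP YX].
by rewrite -(cardsID Y X) -(cardsID X Y) XY YX setIC.
Qed.

Lemma reconfigurable_card X Y : reconfigurable is_tree X Y -> #|X| = #|Y|.
Proof.
case=> p [_]; elim: p X => [|Z p IHp] X /=; first by move=> _ ->.
by case/andP=> /token_jump_card -> /IHp H /H.
Qed.

(** Only one of at least two tokens leaves in a jump, so consecutive sets share a vertex, and each
    set lies in one component. *)
Lemma reconfigurable_connected X Y x y :
    reconfigurable is_tree X Y -> 1 < #|X| -> x \in X -> y \in Y ->
  connect (@edge G) x y.
Proof.
case=> p []; elim: p X x => [|Z p IHp] X x fX /=.
  move=> _ <- _ xX yX; apply: linked_connect xX yX.
  by apply/feasible_linked/fX; rewrite inE.
case/andP=> XZ pp lp X1 xX yY.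
have [z zXZ] : exists z, z \in X :&: Z.
  apply/set0Pn; rewrite -cards_eq0; have /andP[/eqP XZ1 _] := XZ.
  by have := cardsID Z X; rewrite XZ1; lia.
move: zXZ; rewrite inE => /andP[zX zZ].
apply: (@connect_trans _ _ z).
  by apply: linked_connect xX zX; apply/feasible_linked/fX; rewrite inE eqxx.
apply: IHp pp lp _ zZ yY; last by rewrite -(token_jump_card XZ).
by move=> W WZ; apply: fX; rewrite inE WZ orbT.
Qed.

(** A lone token may jump to any vertex, even in another component. *)
Lemma reconfigurable_singletons X Y :
    linked X -> linked Y -> #|X| = 1 -> #|Y| = 1 -> reconfigurable is_tree X Y.
Proof.
move=> lX lY cX cY.
have [->|XY] := eqVneq X Y; first exact: reconfigurable_refl.
apply: reconfigurable_step (reconfigurable_refl lY) => //.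
have [/cards1P[x Xx] /cards1P[y Yy]] : #|X| == 1 /\ #|Y| == 1 by rewrite cX cY.
have xy : x != y by apply: contraNneq XY => xy; rewrite Xx Yy xy.
rewrite /token_jump Xx Yy; apply/andP; split; apply/cards1P; [exists x|exists y];
  apply/setP => z; rewrite !inE.
  by case: (eqVneq z x) => [->|]; rewrite ?andbF ?xy.
by case: (eqVneq z y) => [->|]; rewrite ?andbF // eq_sym xy.
Qed.

Lemma reconfigurableP X Y x y :
    linked X -> linked Y -> x \in X -> y \in Y ->
  reconfigurable is_tree X Y <->
  #|X| = #|Y| /\ (#|X| = 1 \/ connect (@edge G) x y).
Proof.
move=> lX lY xX yY.
have X0 : 0 < #|X| by apply/card_gt0P; exists x.
split=> [r|[cXY cr]].
  split; first exact: reconfigurable_card.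
  have [X1|X1] : 1 < #|X| \/ #|X| = 1 by lia.
    by right; apply: reconfigurable_connected r X1 xX yY.
  by left.
have [X1|X1] : 1 < #|X| \/ #|X| = 1 by lia.
  case: cr => [|cr]; first lia.
  exact: reconfigurable_connect cr X1 cXY.
by apply: reconfigurable_singletons; rewrite -?cXY.
Qed.

(** Count ordered pairs: at most [(a, b)] and [(b, a)] lie over the edge [{a, b}]. This bounds the
    input length by the size of the graph. *)
Lemma sum_degrees_le (adj : G -> seq G) :
    (forall v, uniq (adj v) /\ forall u, (u \in adj v) = edge v u) ->
  \sum_v size (adj v) <= 2 * #|edge_set G|.
Proof.
move=> adjP.
pose E := [set p : G * G | edge p.1 p.2].
pose f (p : G * G) := [set p.1; p.2].
have -> : \sum_v size (adj v) = #|E|.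
  rewrite -sum1_card (eq_bigl (fun p => edge p.1 p.2)); last by move=> p; rewrite inE.
  rewrite -(pair_big_dep xpredT (fun u v => edge u v) (fun _ _ => 1)) /=.
  apply: eq_bigr => v _; have [uv Ev] := adjP v.
  by rewrite sum1_card -(card_uniqP uv); apply: eq_card => u; rewrite Ev.
have -> : edge_set G = f @: E.
  by apply/setP => s; apply/imsetP/imsetP => -[p pE ->]; exists p => //;
    rewrite !inE in pE *.
rewrite -sum1_card (partition_big_imset f) /= -sum1_card big_distrr /=.
apply: leq_sum => _ /imsetP[[a b] _ ->]; rewrite sum1_card.
apply: leq_trans (_ : #|[set (a, b); (b, a)]| <= _); last by rewrite cards2; lia.
apply/subset_leq_card/subsetP => -[c d]; rewrite !inE /f /= => /andP[cd /eqP cdab].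
have ncd : c != d by apply: contraTneq cd => ->; rewrite inE /= edge_irr.
have := set21 c d; have := set22 c d; rewrite cdab !inE !xpair_eqE.
move=> /orP[]/eqP dE /orP[]/eqP cE; rewrite cE dE ?eqxx ?orbT // in ncd *.

Qed.

End Linked.

(** * The random access machine *)

Section Reach.
Variables (P : program) (B : nat).
Implicit Types (s : state) (Q : state -> Prop).

(** A Hoare-style judgement with time and word bounds. Having [fits B s] as a premise inside it lets
    judgements compose without restating the word bound. *)
Definition reach t s Q : Prop :=
  fits B s -> exists t', [/\ t' <= t, Q (run P t' s)
    & forall i, i <= t' -> fits B (run P i s)].

(** Only [Cst] and [Add] can produce a value larger than all those present. *)
Definition bounded (i : instr) (r : nat -> nat) : Prop :=
  match i with
  | Cst _ k => k <= B
  | Add _ a b => r a + r b <= B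
  | _ => True
  end.

Lemma reach_done t s Q : Q s -> reach t s Q.
Proof. by move=> Qs fs; exists 0; split=> // i; rewrite leqn0 => /eqP->. Qed.

Lemma fits_exec i s : bounded i (reg s) -> fits B s -> fits B (exec i s).
Proof.
case: s => q r m /=; case: i => [d k|d a b|d a b|d a|a b|a l] /= ok fs j;
  have [rj mj] := fs j; have [] := fs j => /= _ _; split=> //; rewrite /upd;
  case: eqP => // _.
- by apply: leq_trans (leq_subr _ _) _; have [] := fs a.
- by have [] := fs (r a).
- by have [] := fs b.
Qed.

Lemma reach_step i t s Q :
  onth P (pc s) = Some i -> bounded i (reg s) -> reach t (exec i s) Q ->
  reach t.+1 s Q.
Proof.
move=> Pi ok rQ fs; have fs' := fits_exec ok fs.
have [t' [tt' Qt ft]] := rQ fs'.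
have E k : run P k.+1 s = run P k (exec i s) by rewrite /run iterSr /step Pi.
by exists t'.+1; rewrite E; split=> // -[|k] kt //; rewrite E; apply: ft.
Qed.

Lemma reach_trans t1 t2 s Q1 Q2 :
  reach t1 s Q1 -> (forall s', Q1 s' -> reach t2 s' Q2) -> reach (t1 + t2) s Q2.
Proof.
move=> r1 r2 fs; have [a [at1 Qa fa]] := r1 fs.
have [b [bt2 Qb fb]] := r2 _ Qa (fa _ (leqnn a)).
have E k : run P (a + k) s = run P k (run P a s) by rewrite addnC /run iterD.
exists (a + b); split; [lia | by rewrite E|] => i ile.
have [ia|ai] := leqP i a; first exact: fa.
by rewrite -(subnKC (ltnW ai)) E; apply: fb; lia.
Qed.

Lemma reach_imp t s Q1 Q2 :
  reach t s Q1 -> (forall s', Q1 s' -> Q2 s') -> reach t s Q2.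
Proof.
by move=> rQ Q12 fs; have [a [at1 /Q12 Qa fa]] := rQ fs; exists a.
Qed.

Lemma reach_le t t' s Q : t <= t' -> reach t s Q -> reach t' s Q.
Proof.
by move=> tt' rQ fs; have [a [at1 Qa fa]] := rQ fs; exists a; split=> //; lia.
Qed.

End Reach.

(* Registers: 0 output, 0 until the end; 1 the constant 1; 2 the order n; 3 the
   address of the current block; 4 loop counter; 6 and 9 the addresses of the
   first source and target vertex; 10 start F of the table of block addresses;
   11 start F + n of the marks; 12 and 13 head and tail of the queue, which is
   stored from F + 2n on. The comments give the jump targets. *)
Definition prog : program := [::
  Cst 1 1; Ld 2 0; Add 3 1 0; Add 4 2 0;
  (*  4 *) Jz 4 10; Ld 5 3; Add 3 3 5; Add 3 3 1; Defs.Sub 4 4 1; Jz 0 4;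
  (* 10 *) Ld 5 3; Add 6 3 1; Add 7 6 5; Ld 8 7; Add 9 7 1; Add 10 9 8;
  (* 16 *) Defs.Sub 11 5 8; Defs.Sub 12 8 5; Add 11 11 12; Jz 11 21; Jz 0 65;
  (* 21 *) Defs.Sub 11 5 1; Jz 11 64;
  (* 23 *) Add 3 1 0; Add 4 2 0; Add 11 10 0;
  (* 26 *) Jz 4 34; St 11 3; Add 11 11 1; Ld 5 3; Add 3 3 5; Add 3 3 1;
           Defs.Sub 4 4 1; Jz 0 26;
  (* 34 *) Add 12 11 2; Ld 5 6; Add 7 11 5; St 7 1; St 12 5; Add 13 12 1;
  (* 40 *) Defs.Sub 5 13 12; Jz 5 59; Ld 5 12; Add 12 12 1; Add 5 10 5; Ld 5 5;
           Ld 4 5;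
  (* 47 *) Jz 4 40; Add 5 5 1; Ld 7 5; Add 8 11 7; Ld 14 8; Defs.Sub 4 4 1;
           Defs.Sub 14 1 14; Jz 14 47; St 8 1; St 13 7; Add 13 13 1; Jz 0 47;
  (* 59 *) Ld 5 9; Add 5 11 5; Ld 0 5; Cst 5 0; Jz 5 65;
  (* 64 *) Cst 0 1].

Ltac numeral x := lazymatch x with O => idtac | Datatypes.S ?y => numeral y end.

(** Resolves lookups at literal register numbers by computation; updates at symbolic memory
    addresses are left for explicit case analysis. *)
Ltac upd_simpl := repeat match goal with
  | |- context [upd ?f ?i ?v ?j] =>
      numeral i; numeral j;
      let b := eval vm_compute in (j == i) in
      lazymatch b with
      | true => change (upd f i v j) with v
      | false => change (upd f i v j) with (f j)
      end
  end.

Ltac exec1 :=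
  eapply reach_step; [reflexivity | | ]; cbn [exec bounded reg]; upd_simpl;
  [try exact I | ].

(** * Correctness and running time of the program *)

Section Algorithm.
Implicit Types (q l x : seq nat) (u v i h : nat) (r m : nat -> nat).
Variables (n : nat) (N : nat -> seq nat) (ss ts : seq nat) (B : nat).
Hypothesis Nn : forall v u, v < n -> u \in N v -> u < n.

(* The address of the block of vertex [v] in the input. *)
Definition off v := 1 + \sum_(i < v) (size (N i)).+1.
Arguments off : simpl never.
(** [S] and [T] are the addresses of the source and target blocks, [F] the first cell after the
    input. Behind it come three arrays of length [n]: table, marks, queue. *)
Let S := off n.
Let T := S + 1 + size ss.
Let F := T + 1 + size ts.
Hypothesis FB : F + 3 * n + 1 <= B.

Definition word : seq nat :=
  n :: flatten [seq size (N i) :: N i | i <- iota 0 n]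
    ++ (size ss :: ss) ++ (size ts :: ts).

Lemma offS v : off v.+1 = off v + size (N v) + 1.
Proof. by rewrite /off big_ord_recr /=; lia. Qed.

Lemma off_leq v u : v <= u -> off v <= off u.
Proof.
move=> vu; rewrite -(subnK vu); elim: (u - v) => // k IHk; rewrite addSn offS; lia.
Qed.

Lemma off_lt v : v < n -> off v + size (N v) < S.
Proof. by move=> /off_leq; rewrite offS /S; lia. Qed.

Lemma size_blocks v :
  size (flatten [seq size (N i) :: N i | i <- iota 0 v]) = (off v).-1.
Proof.
elim: v => [|v IHv]; first by rewrite /off big_ord0.
by rewrite -addn1 iotaD map_cat flatten_cat size_cat IHv addn1 offS /= cats0 addn1 addnS.
Qed.

Lemma word_off v i :
  v < n -> i <= size (N v) -> nth 0 word (off v + i) = nth 0 (size (N v) :: N v) i.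
Proof.
move=> vn iN; rewrite /word -[n in iota 0 n](subnKC vn) addSnnS iotaD.
rewrite map_cat flatten_cat -!catA -[off v]prednK // -size_blocks addSn.
rewrite [LHS]/= nth_cat ltnNge leq_addr addKn /= -cat_cons nth_cat /=.
by rewrite ltnS iN.
Qed.

Lemma nth_word_tail i :
  nth 0 word (S + i) = nth 0 ((size ss :: ss) ++ (size ts :: ts)) i.
Proof.
rewrite /word /S -[off n]prednK // -size_blocks addSn.
by rewrite [LHS]/= nth_cat ltnNge leq_addr addKn.
Qed.

Lemma word_source i : i <= size ss -> nth 0 word (S + i) = nth 0 (size ss :: ss) i.
Proof. by move=> si; rewrite nth_word_tail nth_cat /= ltnS si. Qed.

Lemma word_target i : nth 0 word (T + i) = nth 0 (size ts :: ts) i.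
Proof.
by rewrite /T -!addnA nth_word_tail nth_cat addnA /= add1n ltnNge leq_addr addKn.
Qed.

Lemma size_word : size word = F.
Proof.
by rewrite /word [LHS]/= !size_cat size_blocks -addSn prednK //= /F /T /S size_cat /=; lia.
Qed.

Lemma tailE : F = S + size ss + size ts + 2 /\ T = S + size ss + 1.
Proof. by rewrite /F /T; lia. Qed.

Definition input (m : nat -> nat) := forall a, a < F -> m a = nth 0 word a.

(** The first pass skips [i] remaining blocks, six instructions each, to find [S]. Register 0 holds
    0, so [Jz 0 l] is an unconditional jump. *)
Lemma walk i r m :
    i <= n -> input m ->
    [/\ r 0 = 0, r 1 = 1, r 2 = n, r 3 = off (n - i) & r 4 = i] ->
  reach prog B (6 * i + 1) (State 4 r m) (fun s => exists r',
    s = State 10 r' m /\ [/\ r' 0 = 0, r' 1 = 1, r' 2 = n & r' 3 = S]).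
Proof.
elim: i r => [|i IHi] r iN mI [r0 r1 r2 r3 r4].
  exec1; rewrite r4; apply: reach_done; exists r.
  by rewrite r0 r1 r2 r3 subn0.
rewrite mulnS.
have vn : n - i.+1 < n by lia.
have oE : n - i = (n - i.+1).+1 by lia.
have ov := off_lt vn; have [FE _] := tailE.
have mr : m (r 3) = size (N (n - i.+1)).
  by rewrite r3 mI; [have := word_off vn (leq0n _); rewrite addn0 | lia].
exec1; rewrite r4; exec1; rewrite mr.
exec1; first by rewrite r3; lia.
exec1; first by rewrite r3 r1; lia.
exec1; exec1; rewrite r0; apply: IHi => //; first lia.
by upd_simpl; rewrite r0 r1 r2 r3 r4 oE offS; split=> //; lia.
Qed.

Definition table j m :=
  [/\ input m, forall v, v < j -> m (F + v) = off v
    & forall a, F + n <= a -> m a = 0].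

(** The second pass, eight instructions per block, records block addresses, giving the search
    constant-time access to every adjacency list. The marks are still zero afterwards. *)
Lemma walk_store i r m :
    i <= n -> table (n - i) m ->
    [/\ r 0 = 0, r 1 = 1, r 2 = n, r 3 = off (n - i) & r 4 = i] ->
    [/\ r 6 = S + 1, r 9 = T + 1, r 10 = F & r 11 = F + (n - i)] ->
  reach prog B (8 * i + 1) (State 26 r m) (fun s => exists r' m',
    [/\ s = State 34 r' m', table n m', [/\ r' 0 = 0, r' 1 = 1 & r' 2 = n]
      & [/\ r' 6 = S + 1, r' 9 = T + 1, r' 10 = F & r' 11 = F + n]]).
Proof.
elim: i r m => [|i IHi] r m iN [mI mt m0] [r0 r1 r2 r3 r4] [r6 r9 r10 r11].
  rewrite subn0 in r11 mt.
  by exec1; rewrite r4; apply: reach_done; exists r, m.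
rewrite mulnS.
have vn : n - i.+1 < n by lia.
have oE : n - i = (n - i.+1).+1 by lia.
have ov := off_lt vn; have [FE _] := tailE.
have mr : nth 0 word (off (n - i.+1)) = size (N (n - i.+1)).
  by have := word_off vn (leq0n _); rewrite addn0.
exec1; rewrite r4; exec1; exec1; first by rewrite r11 r1; lia.
exec1; set m' := upd m _ _.
have mI' : input m'.
  by move=> a aF; rewrite /m' /upd r11; case: eqP => [|_]; [lia | apply: mI].
have -> : m' (r 3) = size (N (n - i.+1)) by rewrite r3 mI'; [|lia].
exec1; first by rewrite r3; lia.
exec1; first by rewrite r3 r1; lia.
exec1; exec1; rewrite r0; apply: IHi; first lia.
- split=> //.
    move=> v; rewrite oE /m' /upd r11 eqn_add2l ltnS leq_eqVlt.
    by case: eqP => [->|_] //= /mt.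
  move=> a aF; rewrite /m' /upd r11; case: eqP => [|_]; [lia | exact: m0].
- by upd_simpl; rewrite r0 r1 r2 r3 r4 oE offS; split=> //; lia.
- by upd_simpl; rewrite r6 r9 r10 r11 r1 oE; split=> //; lia.
Qed.

(** * Breadth-first search *)

Variable R : nat -> Prop.
Hypothesis RN : forall v u, v < n -> R v -> u \in N v -> R u.

(** Entries are never erased, dequeuing only advances the head; [q] thus lists all vertices
    discovered so far. [R] stands for reachability from the source. *)
Definition queue q := uniq q /\ forall u, u \in q -> u < n /\ R u.

Definition bfs_mem q m :=
  [/\ input m, forall v, v < n -> m (F + v) = off v,
      forall u, u < n -> m (F + n + u) = (u \in q)
    & forall i, i < size q -> m (F + n + n + i) = nth 0 q i].

Definition bfs_reg h (q : seq nat) (r : nat -> nat) :=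
  [/\ r 0 = 0, r 1 = 1, r 9 = T + 1, r 10 = F & r 11 = F + n] /\
  (r 12 = F + n + n + h /\ r 13 = F + n + n + size q).

Lemma queue_size q : queue q -> size q <= n.
Proof.
move=> [uq qn]; rewrite -(size_iota 0 n); apply: uniq_leq_size => // u /qn[un _].
by rewrite mem_iota.
Qed.

Lemma bfs_mem_rcons q m u :
    bfs_mem q m -> size q < n -> u < n ->
  bfs_mem (rcons q u) (upd (upd m (F + n + u) 1) (F + n + n + size q) u).
Proof.
move=> [mI mo mv mq] qn un; split.
- by move=> a aF; rewrite /upd; do 2![case: eqP => [|_]; first lia]; apply: mI.
- by move=> v vn; rewrite /upd; do 2![case: eqP => [|_]; first lia]; apply: mo.
- move=> v vn; rewrite /upd; case: eqP => [|_]; first lia.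
  by rewrite eqn_add2l mem_rcons inE; case: eqP => //= _; apply: mv.
move=> i; rewrite size_rcons ltnS nth_rcons /upd eqn_add2l => iq.
case: eqP => [->|ni]; first by rewrite ltnn.
have iq' : i < size q by lia.
by rewrite iq'; case: eqP => [|_]; [lia | apply: mq].
Qed.

(** [l] is the unread part of an adjacency list, register 5 points to the cell just before it, and
    [x] collects the newly discovered vertices. *)
Lemma scan h l q r m :
    queue q -> bfs_mem q m -> bfs_reg h q r -> r 4 = size l ->
    r 5 + size l < F ->
    (forall i, i < size l -> nth 0 word (r 5 + i.+1) = nth 0 l i) ->
    (forall u, u \in l -> u < n /\ R u) ->
  reach prog B (12 * size l + 1) (State 47 r m) (fun s => exists (x : seq nat) r' m',
    [/\ s = State 40 r' m', queue (q ++ x), bfs_mem (q ++ x) m',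
        bfs_reg h (q ++ x) r' & {subset l <= q ++ x}]).
Proof.
elim: l q r m => [|u l IHl] q r m qq qm [[r0 r1 r9 r10 r11] [r12 r13]] r4 lF wl ln.
  by exec1; rewrite r4; apply: reach_done; exists [::], r, m; rewrite cats0.
have [mI mo mv mq] := qm.
rewrite [size _]/= mulnS -addnA.
have [un Ru] := ln u (mem_head u l).
have uw : m (r 5 + 1) = u.
  by rewrite mI; [rewrite (wl 0) | move: lF => /=; lia].
have ln' v : v \in l -> v < n /\ R v by move=> vl; apply: ln; rewrite inE vl orbT.
rewrite /= in lF.
exec1; rewrite r4; exec1; first by rewrite r1; lia.
exec1; rewrite r1 uw; exec1; first by rewrite r11; lia.
rewrite r11; exec1; rewrite mv //; exec1; exec1; exec1.
have wl' i : i < size l -> nth 0 word (r 5 + 1 + i.+1) = nth 0 l i.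
  by move=> il; rewrite -addnA add1n (wl i.+1).
rewrite r1; have [uq|uq] := boolP (u \in q).
  (* A marked neighbour takes only eight of the twelve instructions. *)
  apply: (@reach_le _ _ (12 * size l + 1)); first exact: (leq_addl 4).
  apply: reach_imp.
    apply: (IHl q _ m qq qm); rewrite /bfs_reg; upd_simpl => //.
    - by rewrite r4 subn1.
    - lia.
  move=> _ [x [r' [m' [-> qx mx rx lx]]]]; exists x, r', m'; split=> // v.
  by rewrite inE => /orP[/eqP->|/lx//]; rewrite mem_cat uq.
have quq : queue (rcons q u).
  split; first by rewrite rcons_uniq uq; case: qq.
  by move=> v; rewrite mem_rcons inE => /orP[/eqP->//|/(proj2 qq)].
have sq : size q < n by have := queue_size quq; rewrite size_rcons.
exec1; exec1; exec1; first by rewrite r13 r1; lia.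
exec1; rewrite r0; apply: reach_imp.
  apply: (IHl (rcons q u) _ _ quq); rewrite /bfs_reg; upd_simpl => //.
  - by rewrite r13 r1; apply: bfs_mem_rcons.
  - by rewrite r13 r1 size_rcons -[(size q).+1]addn1 !addnA.
  - by rewrite r4 subn1.
  - lia.
move=> _ [x [r' [m' [-> qx mx rx lx]]]]; rewrite cat_rcons in qx mx rx lx.
exists (u :: x), r', m'; split=> // v.
by rewrite inE => /orP[/eqP->|/lx//]; rewrite mem_cat mem_head orbT.
Qed.

Definition closed_upto h q :=
  forall i, i < h -> {subset N (nth 0 q i) <= q}.

(** Amortized bound: each vertex [v] outside the first [h] entries has yet to pay
    [12 * size (N v) + 8], and pays once since entries are distinct. The 2 is the final emptiness
    test. *)
Lemma bfs h q r m :
    queue q -> bfs_mem q m -> bfs_reg h q r -> h <= size q -> closed_upto h q ->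
  reach prog B (2 + \sum_(v < n | val v \notin take h q) (12 * size (N v) + 8))
    (State 40 r m) (fun s => exists (x : seq nat) h' r' m',
    [/\ s = State 59 r' m', queue (q ++ x), bfs_mem (q ++ x) m',
        bfs_reg h' (q ++ x) r' & closed_upto (size (q ++ x)) (q ++ x)]).
Proof.
move: {2}(n - h).+1 (ltnSn (n - h)) => k.
elim: k h q r m => // k IHk h q r m hk qq qm qr hq qc.
have [[r0 r1 r9 r10 r11] [r12 r13]] := qr.
have [hE|hE] := eqVneq h (size q).
  exec1; exec1; rewrite r12 r13 hE subnn; apply: reach_done.
  exists [::], h, (upd r 5 0), m; rewrite cats0; split=> //.
  by rewrite -hE.
have hs : h < size q by rewrite ltn_neqAle hE.
have [v [vE vn Rv]] : exists v, [/\ nth 0 q h = v, v < n & R v].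
  by exists (nth 0 q h); have [] := (proj2 qq) _ (mem_nth 0 hs).
have qn := queue_size qq.
have [mI mo mv mq] := qm; have ov := off_lt vn; have [FE _] := tailE.
have mh : m (r 12) = v by rewrite r12 mq.
have mN : m (off v) = size (N v).
  by rewrite mI; [have := word_off vn (leq0n _); rewrite addn0 | lia].
have vh : v \notin take h q.
  by rewrite -vE in_take ?mem_nth // index_uniq ?ltnn //; case: qq.
rewrite (bigD1 (Ordinal vn)) //=.
set rest := \sum_(i < n | _) _.
(* Seven instructions dequeue [v] and load its degree; the eighth is the final test of the scan. *)
have -> : 2 + (12 * size (N v) + 8 + rest) =
  7 + ((12 * size (N v) + 1) + (2 + rest)) by lia.
exec1; exec1; have -> : r 13 - r 12 = (size q - h.+1).+1 by lia.
exec1; rewrite mh; exec1; first by rewrite r12 r1; lia.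
exec1; first by rewrite r10; lia.
exec1; rewrite r10 mo //; exec1; rewrite mN.
apply: reach_trans.
  apply: (scan (h := h.+1) (l := N v) (q := q)) => //; rewrite /bfs_reg; upd_simpl => //.
  - by rewrite r12 r1 -[h.+1]addn1 !addnA.
  - by lia.
  - by move=> i iN; rewrite word_off.
  - by move=> u uN; split; [apply: Nn uN | apply: RN uN].
move=> _ [x [r' [m' [-> qx mx rx Nx]]]].
have sq : h < size (q ++ x) by rewrite size_cat; lia.
(* Appending [x] leaves the first [h.+1] entries unchanged, so exactly [v] has left the set of
   unpaid vertices. *)
have restE : rest =
    \sum_(w < n | val w \notin take h.+1 (q ++ x)) (12 * size (N w) + 8).
  apply: eq_bigl => w; rewrite takel_cat // (take_nth 0) // vE mem_rcons inE negb_or.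
  by rewrite andbC -(inj_eq val_inj).
rewrite restE; apply: reach_imp.
  apply: (IHk h.+1 (q ++ x)) => //; first by lia.
  move=> i; rewrite ltnS leq_eqVlt nth_cat => /orP[/eqP->|ih].
    by rewrite hs vE.
  by rewrite (ltn_trans ih hs) => u /(qc _ ih); rewrite mem_cat => ->.
move=> _ [y [h' [r2 [m2 [-> qy my ry cy]]]]].
by exists (x ++ y), h', r2, m2; rewrite catA.
Qed.

Hypothesis s0R : R (nth 0 ss 0).
Hypothesis Rmin : forall q, nth 0 ss 0 \in q ->
  (forall v, v \in q -> {subset N v <= q}) -> forall v, R v -> v \in q.
Hypothesis ssn : 0 < size ss /\ forall u, u \in ss -> u < n.
Hypothesis tsn : 0 < size ts /\ forall u, u \in ts -> u < n.

(** All entries of the final queue satisfy [R]; being closed under adjacency, it contains all of [R]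
    by [Rmin]. Hence the mark of the first target vertex is the answer. *)
Lemma search r m :
    table n m -> [/\ r 0 = 0, r 1 = 1 & r 2 = n] ->
    [/\ r 6 = S + 1, r 9 = T + 1, r 10 = F & r 11 = F + n] ->
  reach prog B (13 + (12 * off n)) (State 34 r m) (fun s => exists b : bool,
    [/\ pc s = 65, reg s 0 = b & b <-> R (nth 0 ts 0)]).
Proof.
move=> [mI mo m0] [r0 r1 r2] [r6 r9 r10 r11].
set s0 := nth 0 ss 0; set t0 := nth 0 ts 0.
have [ss0 /(_ s0 (mem_nth 0 ss0)) s0n] := ssn.
have [ts0 /(_ t0 (mem_nth 0 ts0)) t0n] := tsn.
have [FE TE] := tailE.
have ms : m (S + 1) = s0.
  by rewrite mI; [rewrite word_source // | lia].
(* Six instructions set up the queue and five output the mark. *)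
apply: (@reach_le _ _ (6 + ((2 + \sum_(v < n | val v \notin take 0 [:: s0])
    (12 * size (N v) + 8)) + 5))).
  have -> : \sum_(v < n | val v \notin take 0 [:: s0]) (12 * size (N v) + 8) =
      \sum_(v < n) (12 * size (N v) + 8) by apply: eq_bigl.
  have : \sum_(v < n) (12 * size (N v) + 8) <= 12 * \sum_(v < n) (size (N v)).+1.
    by rewrite big_distrr; apply: leq_sum => v _ /=; rewrite mulnS addnC leq_add2r.
  rewrite /off; set X := \sum_(v < n) _; set Y := \sum_(v < n) _; lia.
exec1; first by rewrite r11 r2; lia.
exec1; rewrite r6 ms r11 r2.
exec1; rewrite ?r11; first lia.
exec1; rewrite r1; exec1; exec1; first lia.
apply: reach_trans.
  apply: (bfs (h := 0) (q := [:: s0])) => //.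
  - by split=> // u; rewrite inE => /eqP->.
  - have : bfs_mem [::] m.
      split=> // u un; rewrite m0 //; lia.
    move=> /bfs_mem_rcons/(_ (leq_ltn_trans _ s0n) s0n) /=.
    by rewrite addn0; apply.
  - by rewrite /bfs_reg; upd_simpl; rewrite addn0 ?r1.
move=> _ [x [h [r' [m' [-> [uq qR] [mI' mo' mv' mq'] [[r0' r1' r9' r10' r11'] _] cq]]]]].
set q := [:: s0] ++ x in uq qR mv' mq' cq.
have mt : m' (T + 1) = t0.
  by rewrite mI'; [rewrite word_target | lia].
exec1; rewrite r9' mt; exec1; first by rewrite r11'; lia.
(* Register 0 now holds the answer, so the jump to the exit tests register 5, freshly set to 0. *)
exec1; rewrite r11' mv' //; exec1 => //; exec1.
apply: reach_done; exists (t0 \in q); split=> //.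
split=> [/qR[]//|]; apply: Rmin; first exact: mem_head.
by move=> v vq u uN; apply: (cq (index v q)); rewrite ?index_mem ?nth_index.
Qed.
Lemma fits_init : fits B (init word).
Proof.
have [FE TE] := tailE; have nB : n <= B by lia.
have ltB u : u < n -> u <= B by lia.
suff wB : forall u, u \in word -> u <= B.
  move=> k; split=> //=; have [kw|kw] := ltnP k (size word).
    exact: wB (mem_nth 0 kw).
  by rewrite nth_default.
move=> u; rewrite inE => /orP[/eqP->//|]; rewrite mem_cat => /orP[].
  case/flattenP => s /mapP[i]; rewrite mem_iota => /= iN ->.
  have ov := off_lt iN; rewrite inE => /orP[/eqP->|/(Nn iN)/ltB//]; lia.
rewrite mem_cat !inE => /orP[]/orP[/eqP->|]; try lia.
  by move=> /(proj2 ssn)/ltB.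
by move=> /(proj2 tsn)/ltB.
Qed.

Lemma prog_correct :
  reach prog B (50 * off n) (init word) (fun s => exists b : bool,
    [/\ halted prog s, reg s 0 = b
      & b <-> size ss = size ts /\ (size ss = 1 \/ R (nth 0 ts 0))]).
Proof.
have [FE TE] := tailE.
have nS : n < S.
  by rewrite /S /off; have : \sum_(i < n) 1 <= \sum_(i < n) (size (N i)).+1;
    [apply: leq_sum | rewrite sum1_card card_ord add1n ltnS].
have [ss0 _] := ssn; have [ts0 _] := tsn.
set m := nth 0 word; have mI : input m by [].
have m0 a : F + n <= a -> m a = 0.
  by move=> Fa; rewrite /m nth_default // size_word; lia.
set r : nat -> nat := fun=> 0; have rE k : r k = 0 by [].
(* Initialization, first pass, fifteen instructions of tests and setup, second pass, search;
   [n < off n] absorbs the terms in [n]. *)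
apply: (@reach_le _ _ (4 + ((6 * n + 1) + (15 + ((8 * n + 1) + (13 + 12 * off n)))))).
  by rewrite /S in nS; lia.
rewrite /init -/r -/m.
exec1; first lia.
exec1; rewrite rE (_ : m 0 = n) //.
exec1; first by rewrite rE; lia.
exec1; first by rewrite rE; lia.
rewrite !rE; apply: reach_trans.
  by apply: walk => //; upd_simpl; rewrite !addn0 subnn /off big_ord0.
move=> _ [{}r [-> [r0 r1 r2 r3]]] {rE}.
have ms : m S = size ss.
  by rewrite mI; [have := word_source (leq0n _); rewrite addn0 | lia].
have mt : m T = size ts by rewrite mI; [have := word_target 0; rewrite addn0 | lia].
exec1; rewrite r3 ms; exec1; rewrite r3 r1; first lia.
exec1; first lia.
have -> : S + 1 + size ss = T by lia.
exec1; rewrite mt.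
exec1; rewrite ?r1; first lia.
exec1; first lia.
exec1; exec1; exec1; first lia.
exec1.
(* The truncated differences in both directions add up to zero exactly when the sizes agree. *)
have [eqst|neqst] := eqVneq (size ss) (size ts); last first.
  have -> : (size ss - size ts + (size ts - size ss) == 0) = false by lia.
  exec1; rewrite r0; apply: reach_done; exists false; split=> //.
  by split=> // -[E _]; rewrite E eqxx in neqst.
rewrite eqst subnn /=.
exec1; exec1; rewrite r1.
have [s1|s1] := eqVneq (size ts) 1.
  rewrite s1; exec1; first lia.
  apply: reach_done; exists true; split=> //; split=> // _; split=> //; by left.
have -> : (size ts - 1 == 0) = false by lia.
exec1; first by rewrite r1; lia.
exec1; first by rewrite r2 r0; lia.
exec1; first by rewrite r0; lia.
rewrite r0 r1 r2 !addn0; apply: reach_trans.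
  apply: walk_store => //; upd_simpl; rewrite ?subnn ?addn0 //.
  by rewrite /off big_ord0.
move=> _ [r' [m' [-> tm r012 rs]]].
apply: reach_imp; first exact: search.
move=> s [b [ps rb bR]]; exists b; split=> //; first by rewrite /halted ps.
by split=> [/bR Rt|[_ [ss1|/bR//]]]; [split=> //; right | rewrite ss1 eqxx in s1].
Qed.

End Algorithm.

(** * Encoded graphs *)

(** As [k.+2] is at least 2, its cube is at least 8. This turns a linear bound on addresses into the
    required word bound. *)
Lemma leq_expn_mul8 k c : 4 <= c -> 8 * k.+2 <= k.+2 ^ c.
Proof.
move=> c4; apply: leq_trans (leq_pexp2l (isT : 0 < k.+2) c4).
by rewrite expnSr leq_mul2r (leq_exp2r 2 k.+2 (isT : 0 < 3)).
Qed.

Section Encoding.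
Variables (G : sgraph) (g0 : G) (vs : seq G) (adj : G -> seq G).
Hypothesis vsP : uniq vs /\ forall v, v \in vs.
Hypothesis adjP : forall v, uniq (adj v) /\ forall u, (u \in adj v) = edge v u.

Let n := #|G|.

Definition code (s : seq G) : seq nat := [seq index v vs | v <- s].

Definition code_adj i : seq nat := code (adj (nth g0 vs i)).

Lemma size_vs : size vs = n.
Proof.
by have [/card_uniqP <- vsT] := vsP; apply: eq_card => v; rewrite vsT.
Qed.

Lemma index_lt v : index v vs < n.
Proof. by rewrite -size_vs index_mem; case: vsP. Qed.

Lemma code_lt s u : u \in code s -> u < n.
Proof. by case/mapP => v _ ->; apply: index_lt. Qed.

Lemma code_word ss ts :
  n :: flatten [seq block vs (adj v) | v <- vs] ++ block vs ss ++ block vs ts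
  = word n code_adj (code ss) (code ts).
Proof.
rewrite /word /block !size_map; congr (_ :: flatten _ ++ _).
rewrite -[X in [seq _ | v <- X]](mkseq_nth g0 vs) /mkseq size_vs -map_comp.
by apply: eq_map => i /=; rewrite /code_adj size_map.
Qed.

Lemma off_code : off code_adj n <= 1 + n + 2 * #|edge_set G|.
Proof.
have -> : off code_adj n = 1 + (n + \sum_v size (adj v)).
  rewrite /off; congr (1 + _).
  rewrite (eq_bigr (fun i : 'I_n => 1 + size (code_adj i))) // big_split /= sum1_card card_ord.
  congr (_ + _); have [uvs vsT] := vsP.
  rewrite (eq_bigl (mem vs)) => [|v]; last by rewrite inE vsT.
  rewrite -(big_uniq _ uvs) (big_nth g0) big_mkord size_vs.
  by apply: eq_bigr => i _; rewrite size_map.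
by rewrite -addnA !leq_add2l sum_degrees_le.
Qed.

(** The condition [i < n] excludes numbers at which [nth] would return the default [g0]. *)
Definition code_reach (s : G) i := i < n /\ connect (@edge G) s (nth g0 vs i).

Lemma code_reach_index s v : code_reach s (index v vs) <-> connect (@edge G) s v.
Proof.
rewrite /code_reach nth_index ?index_lt; last by case: vsP.
by split=> [[]|].
Qed.

Lemma code_reach_adj s i u :
  i < n -> code_reach s i -> u \in code_adj i -> code_reach s u.
Proof.
move=> iN [_ si] /mapP[v va ->]; apply/code_reach_index.
by apply: connect_trans si (connect1 _); rewrite -(adjP _).2.
Qed.

(** Induction along a path from [s]: closure passes membership from each vertex to the next. *)
Lemma code_reach_min s (q : seq nat) :
    index s vs \in q -> (forall i, i \in q -> {subset code_adj i <= q}) ->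
  forall i, code_reach s i -> i \in q.
Proof.
move=> sq qc i [iN /connectP[p + iE]].
have -> : i = index (last s p) vs by rewrite -iE index_uniq ?size_vs //; case: vsP.
elim: p s sq {iE} => //= v p IHp s sq /andP[sv vp]; apply: IHp vp.
apply: qc sq _ _; apply/mapP; exists v => //.
by rewrite nth_index ?(adjP _).2 //; case: vsP.
Qed.

End Encoding.

Theorem theorem11 : linear_time (spanning_tj_reconf is_tree).
Proof.
(* As a factor, 100 covers [50 * (1 + n + 2 * e)] with [e] edges; as an exponent it only has to be
   at least 4. *)
exists prog, 100 => -[G X Y] w /= [/feasible_linked lX /feasible_linked lY].
move=> [vs [adj [ss [ts /= [vsP adjP [uss ssX] [uts tsY] wE]]]]].
have /set0Pn[g0 g0X] := lX.1; have /set0Pn[g1 g1Y] := lY.1.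
have css : size ss = #|X| by rewrite -(eq_card ssX); apply/esym/card_uniqP.
have cts : size ts = #|Y| by rewrite -(eq_card tsY); apply/esym/card_uniqP.
have ss0 : 0 < size ss by rewrite css; apply/card_gt0P; exists g0.
have ts0 : 0 < size ts by rewrite cts; apply/card_gt0P; exists g1.
set s0 := nth g0 ss 0; set t0 := nth g0 ts 0.
have s0X : s0 \in X by rewrite -ssX mem_nth.
have t0Y : t0 \in Y by rewrite -tsY mem_nth.
set e := #|edge_set G|.
have cX : #|X| <= #|G| := max_card _.
have cY : #|Y| <= #|G| := max_card _.
have offE := off_code g0 vsP adjP; rewrite -/e in offE.
have timeE : 50 * off (code_adj g0 vs adj) #|G| <= 100 * (#|G| + e).+1.
  by move: offE; clear; lia.
set B := (#|G| + e).+2 ^ 100.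
have codes : nth 0 (code vs ss) 0 = index s0 vs by rewrite (nth_map g0).
have codet : nth 0 (code vs ts) 0 = index t0 vs by rewrite (nth_map g0).
have FB : off (code_adj g0 vs adj) #|G| + 1 + size (code vs ss) + 1
    + size (code vs ts) + 3 * #|G| + 1 <= B.
  (* Source and target have at most [n] vertices each, so the left side is at most
     [6 * n + 2 * e + 4]. *)
  apply: leq_trans (leq_expn_mul8 _ (isT : 4 <= 100)).
  by rewrite !size_map css cts; move: offE cX cY; clear; lia.
have Nn v u : v < #|G| -> u \in code_adj g0 vs adj v -> u < #|G|.
  by move=> _; apply: code_lt.
have ssn : 0 < size (code vs ss) /\ forall u, u \in code vs ss -> u < #|G|.
  by rewrite size_map; split=> // u; apply: code_lt.
have tsn : 0 < size (code vs ts) /\ forall u, u \in code vs ts -> u < #|G|.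
  by rewrite size_map; split=> // u; apply: code_lt.
have sR : code_reach g0 vs s0 (nth 0 (code vs ss) 0).
  by rewrite codes; apply/(code_reach_index g0 vsP)/connect0.
have Rmin (q : seq nat) : nth 0 (code vs ss) 0 \in q ->
    (forall i, i \in q -> {subset code_adj g0 vs adj i <= q}) ->
  forall i, code_reach g0 vs s0 i -> i \in q.
  by rewrite codes; apply: (code_reach_min vsP adjP).
have := prog_correct Nn FB (@code_reach_adj G g0 vs adj vsP adjP s0) sR Rmin ssn tsn.
move=> /(_ (fits_init Nn FB ssn tsn)).
rewrite codet -(code_word g0 adj vsP) -wE => -[t [tT [b [hb rb bP]] fb]].
exists b; split; last first.
  exists t; split=> //; apply: leq_trans tT timeE.
rewrite bP (code_reach_index g0 vsP) !size_map css cts.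
exact: iff_sym (reconfigurableP lX lY s0X t0Y).
Qed.
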